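(* Let $R$ be a Lie conformal algebra. For any $\alpha,\beta,\gamma\in\mathbb{C}$, $CDer_{(\alpha,\beta,\gamma)}R$ is equal to one of the following subspaces of $Cend\,R$ (and the stated equalities hold): (i) $CDer_{(0,0,0)}R=Cend\,R$. (ii) $CDer_{(1,0,0)}R=\{D_\lambda\in Cend\,R\mid D_\lambda([R,R])=0\}$. (iii) $CDer_{(0,1,-1)}R=QC(R)$. (iv) $CDer_{(\delta,1,-1)}R=CDer_{(0,1,-1)}R\cap CDer_{(1,0,0)}R$, where $\delta\in\mathbb{C}$, $\delta\neq0$. (v) $CDer_{(\delta,1,1)}R$, where $\delta\in\mathbb{C}$. (vi) $CDer_{(\delta,1,0)}R=CDer_{(0,1,-1)}R\cap CDer_{(2\delta,1,1)}R$, where $\delta\in\mathbb{C}$.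
   Context: Let $\mathcal{A}=\mathbb{C}[\partial]$. A Lie conformal algebra is an $\mathcal{A}$-module $R$ with a $\mathbb{C}$-bilinear map $R\otimes R\to R[\lambda]$, $a\otimes b\mapsto[a_\lambda b]$, such that for all $a,b,c\in R$: $[\partial a_\lambda b]=-\lambda[a_\lambda b]$, $[a_\lambda\partial b]=(\partial+\lambda)[a_\lambda b]$; $[a_\lambda b]=-[b_{-\lambda-\partial}a]$; $[a_\lambda[b_\mu c]]=[[a_\lambda b]_{\lambda+\mu}c]+[b_\mu[a_\lambda c]]$. $[R,R]$ is the $\mathbb{C}$-linear span of all $\lambda$-coefficients of the products $[a_\lambda b]$, $a,b\in R$. $Cend\,R$ is the set of conformal linear maps from $R$ to $R$, i.e. $\mathbb{C}$-linear maps $D_\lambda:R\to R[\lambda]$ with $D_\lambda(\partial a)=(\partial+\lambda)D_\lambda(a)$ for all $a\in R$. Brackets such as $[(D_\lambda a)_{\lambda+\mu}b]$ are extended linearly over polynomials in the indeterminates. For $\alpha,\beta,\gamma\in\mathbb{C}$, the set of conformal $(\alpha,\beta,\gamma)$-derivations is $CDer_{(\alpha,\beta,\gamma)}R=\{D_\lambda\in Cend\,R\mid\alpha D_\lambda([a_\mu b])=[(\beta D_\lambda a)_{\lambda+\mu}b]+[a_\mu(\gamma D_\lambda b)]\ \forall a,b\in R\}$. $QC(R)$ (conformal quasicentroids): $D_\lambda\in Cend\,R$ with $[(D_\lambda a)_{\lambda+\mu}b]=[a_\mu(D_\lambda b)]$ for all $a,b\in R$. *)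

(* Defs.v *)
From HB Require Import structures.
From mathcomp Require Import all_boot all_order all_algebra.
From mathcomp Require Import boolp classical_sets functions reals.
From mathcomp Require Import finmap complex monalg.

Set Implicit Arguments.
Unset Strict Implicit.
Unset Printing Implicit Defensive.

Import GRing.Theory Num.Theory.

Local Open Scope ring_scope.

(* [polym M] is M[x] for a module M over a commutative ring S; it is a module
   over S[x], so that [polym (polym M)] = M[x][y] is a module over S[x][y].
   The coefficient of x^n in p is [p@_n]. Unfolding the reverse coercion makes
   the index type syntactically the canonical choiceType of nat, on which the
   rewriting lemmas of monalg match. *)
Definition polym (S : comNzRingType) (M : lmodType S) : Type :=
  Eval cbv [reverse_coercion] in {malg M[nat]}.

Section PolyModule.
Context (S : comNzRingType) (M : lmodType S).

HB.instance Definition _ := GRing.Zmodule.copy (polym M) {malg M[nat]}.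

Implicit Types (q r : {poly S}) (p : polym M).

Definition polym_scale q p : polym M :=
  \sum_(n <- msupp p) \sum_(i < size q) << q`_i *: p@_n *g (i + n)%N >>.

Lemma coef_polym_scale q p k :
  (polym_scale q p)@_k = \sum_(i < k.+1) q`_i *: p@_(k - i)%N.
Proof.
have supp0 n : n \notin msupp p -> p@_n = 0 by apply: mcoeff_outdom.
rewrite /polym_scale raddf_sum /=.
under eq_bigr => n _ do rewrite raddf_sum /=.
rewrite exchange_big /=.
have E (i : nat) : \sum_(n <- msupp p) (<< q`_i *: p@_n *g (i + n)%N >>)@_k
    = if (i <= k)%N then q`_i *: p@_(k - i)%N else 0.
  case: leqP => ik; last first.
    rewrite big1 // => n _; rewrite mcoeffU.
    by case: eqP => // e; rewrite -e ltnNge leq_addr in ik.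
  have [ks|ks] := boolP ((k - i)%N \in msupp p).
    rewrite (bigD1_seq (k - i)%N) ?fset_uniq //.
    rewrite mcoeffU subnKC // eqxx mulr1n big1 => [|n /eqP nk]; first exact: addr0.
    rewrite mcoeffU; case: eqP => // e.
    by case: nk; rewrite -e addKn.
  rewrite (supp0 _ ks) scaler0 big1_seq // => n /andP[_ ns]; rewrite mcoeffU.
  by case: eqP => // e; rewrite -e addKn ns in ks.
under eq_bigr => i _ do rewrite E.
rewrite -(big_mkord xpredT (fun i => if (i <= k)%N then q`_i *: p@_(k - i)%N else 0)).
rewrite -(big_mkord xpredT (fun i => q`_i *: p@_(k - i)%N)).
pose m := maxn (size q) k.+1.
rewrite [LHS](big_nat_widen _ _ m) ?leq_maxl //.
rewrite [RHS](big_nat_widen _ _ m) ?leq_maxr //.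
rewrite big_mkcond [RHS]big_mkcond /=; apply: eq_bigr => i _.
rewrite ltnS; case: ltnP => // qi.
by rewrite nth_default // scale0r if_same.
Qed.

Fact polym_scaleA q r p :
  polym_scale q (polym_scale r p) = polym_scale (q * r) p.
Proof.
apply/malgP => n; rewrite !coef_polym_scale.
pose coef3 j i := q`_j *: (r`_(i - j)%N *: p@_(n - i)%N).
transitivity (\sum_(j < n.+1) \sum_(i < n.+1 | (j <= i)%N) coef3 j i).
  apply: eq_bigr => /= j _; rewrite coef_polym_scale scaler_sumr.
  rewrite -(big_mkord (fun i => (j <= i)%N) (coef3 j)).
  rewrite -(big_mkord xpredT (fun i => q`_j *: (r`_i *: p@_(n - j - i)%N))).
  rewrite [RHS](big_cat_nat _ (n := j)) ?leq0n //=; last by rewrite ltnW.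
  rewrite [X in _ = X + _]big_nat_cond [X in _ = X + _]big1 => [|i]; last first.
    by case/andP=> /andP[_ ij] ji; rewrite ltnNge ji in ij.
  rewrite add0r.
  rewrite -[X in index_iota X n.+1]add0n big_addn subSn ?(ltnSE (ltn_ord j)) //.
  rewrite [RHS]big_mkcond; apply: eq_bigr => i _.
  by rewrite leq_addl /coef3 addnK addnC subnDA.
rewrite (exchange_big_dep predT) //=; apply: eq_bigr => i _.
rewrite coefM scaler_suml -(big_mkord (fun j => (j <= i)%N) (fun j => coef3 j i)).
rewrite -(big_mkord xpredT (fun j => (q`_j * r`_(i - j)%N) *: p@_(n - i)%N)).
rewrite [RHS](big_nat_widen _ _ n.+1) ?ltn_ord //.
by apply: eq_big => [j|j _]; rewrite ?ltnS // /coef3 scalerA.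
Qed.

Fact polym_scale1 : left_id 1 polym_scale.
Proof.
move=> p; apply/malgP => n; rewrite coef_polym_scale big_ord_recl subn0.
rewrite coef1 scale1r big1 ?addr0 // => i _.
by rewrite coef1 scale0r.
Qed.

Fact polym_scaleDr : right_distributive polym_scale +%R.
Proof.
move=> q p1 p2; apply/malgP => n; rewrite mcoeffD !coef_polym_scale -big_split.
by apply: eq_bigr => i _; rewrite mcoeffD scalerDr.
Qed.

Fact polym_scaleDl p : {morph polym_scale^~ p : q r / q + r}.
Proof.
move=> q r; apply/malgP => n; rewrite mcoeffD !coef_polym_scale -big_split.
by apply: eq_bigr => i _; rewrite coefD scalerDl.
Qed.

HB.instance Definition _ := GRing.Zmodule_isLmodule.Build {poly S} (polym M)
  polym_scaleA polym_scale1 polym_scaleDr polym_scaleDl.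

Definition polymC (m : M) : polym M := << m *g 0%N >>.

(* Substitution of q for the indeterminate x: sum_n q^n iota(p_n). *)
Definition polym_eval (S' : comNzRingType) (N : lmodType S') (iota : M -> N)
    (q : S') (p : polym M) : N :=
  \sum_(n <- msupp p) q ^+ n *: iota p@_n.

End PolyModule.

(* A = C[d] with d = 'X, where C is the field K[i] of complex numbers over
   K : realType. For an A-module R, polym R = R[lambda] is an A[lambda]-module
   in which lambda = 'X and d = 'X%:P. *)
Notation Cdiff K := {poly K[i]}.

Section Brackets.
Context (K : realType) (R : lmodType (Cdiff K)).

(* R[lambda, mu] is R[lambda][mu] = polym (polym R), an A[lambda][mu]-module. *)
Definition lam : {poly {poly Cdiff K}} := 'X%:P.
Definition mu : {poly {poly Cdiff K}} := 'X.

(* [at2 f q v s] is f_q(v(s)) in R[lambda, mu], i.e. the linear extension of f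
   over polynomials: if v = sum_n v_n x^n, it is sum_n s^n f_q(v_n). *)
Definition at2 (f : R -> polym R) (q : {poly {poly Cdiff K}})
    (v : polym R) (s : {poly {poly Cdiff K}}) : polym (polym R) :=
  polym_eval (fun x => polym_eval (fun m => polymC (polymC m)) q (f x)) s v.

(* The complex numbers act on A-modules through the constants c%:P of
   A = C[d], and on R[lambda] through c%:P%:P. *)
Definition Clinear (f : R -> polym R) : Prop :=
  forall (c : K[i]) (a b : R), f (c%:P *: a + b) = c%:P%:P *: f a + f b.

End Brackets.

Arguments lam {K}.
Arguments mu {K}.

Record lieConformal (K : realType) := LieConformal {
  lc_sort :> lmodType (Cdiff K);
  bracket : lc_sort -> lc_sort -> polym lc_sort;
  bracket_linearl : forall b, Clinear (bracket^~ b);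
  bracket_linearr : forall a, Clinear (bracket a);
  bracket_dl : forall a b,
    bracket ('X *: a) b = - ('X *: bracket a b);
  bracket_dr : forall a b,
    bracket a ('X *: b) = ('X%:P + 'X) *: bracket a b;
  bracket_skew : forall a b,
    bracket a b = - polym_eval (@polymC _ lc_sort) (- 'X - 'X%:P) (bracket b a);
  bracket_jacobi : forall a b c,
    at2 (bracket a) lam (bracket b c) mu =
    at2 (bracket^~ c) (lam + mu) (bracket a b) lam +
    at2 (bracket b) mu (bracket a c) lam
}.

Arguments bracket {K l} _ _.

Section Derivations.
Context (K : realType) (R : lieConformal K).

Local Open Scope classical_set_scope.

Definition Cspan (X : set R) : set R :=
  [set x | exists (n : nat) (c : 'I_n -> K[i]) (v : 'I_n -> R),
     (forall i, X (v i)) /\ x = \sum_(i < n) (c i)%:P *: v i].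

Definition derived : set R :=
  Cspan [set x | exists (a b : R) (n : nat), x = (bracket a b)@_n].

Definition Cend : set (R -> polym R) :=
  [set D | Clinear D /\ forall a, D ('X *: a) = ('X%:P + 'X) *: D a].

Definition CDer (alpha beta gamma : K[i]) : set (R -> polym R) :=
  [set D | Cend D /\ forall a b : R,
     alpha%:P%:P%:P *: at2 D lam (bracket a b) mu =
     at2 (bracket^~ b) (lam + mu) (beta%:P%:P *: D a) lam +
     at2 (bracket a) mu (gamma%:P%:P *: D b) lam].

Definition QC : set (R -> polym R) :=
  [set D | Cend D /\ forall a b : R,
     at2 (bracket^~ b) (lam + mu) (D a) lam = at2 (bracket a) mu (D b) lam].

(* C-subspaces of Cend R, for the pointwise operations. *)
Definition Csubspace (V : set (R -> polym R)) : Prop :=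
  [/\ V `<=` Cend, V 0 &
      forall (c : K[i]) D E, V D -> V E -> V (c%:P%:P *: D + E)].

End Derivations.

Arguments derived {K} R.
Arguments Cend {K} R.
Arguments CDer {K} R.
Arguments QC {K} R.

(* Main.v *)
Require Import Defs.
From HB Require Import structures.
From mathcomp Require Import all_boot all_order all_algebra.
From mathcomp Require Import boolp classical_sets functions reals.
From mathcomp Require Import finmap complex monalg.
From mathcomp Require Import ring.

Set Implicit Arguments.
Unset Strict Implicit.
Unset Printing Implicit Defensive.

Import GRing.Theory Num.Theory.

Local Open Scope ring_scope.
Local Open Scope classical_set_scope.

(** The three sides of the defining identity of an (alpha, beta, gamma)-derivation
are
  - T(a, b) = D_lambda [a_mu b],
  - L(a, b) = [(D_lambda a)_{lambda+mu} b],
  - N(a, b) = [a_mu (D_lambda b)],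
and the identity is the linear relation alpha T = beta L + gamma N, for all a
and b, in R[lambda, mu]. Two symmetries of this relation give everything.

First, for a fixed D the triples (alpha, beta, gamma) satisfying it form a
linear subspace of C^3 ([CDer_comb]).

Second, this subspace is stable under exchanging beta and gamma ([CDer_swap]).
Let s be the substitution mu := - lambda - mu - d on R[lambda, mu]. Skew-symmetry
of the bracket, together with the sesquilinearity of D, gives
  T(a, b) = - s T(b, a),   L(a, b) = - s N(b, a),   N(a, b) = - s L(b, a)
([derive_bracketC], [bracketl_skew], [bracketr_skew]), so that applying - s to
the relation for (b, a) yields the relation for (a, b) with beta and gamma
exchanged.

Hence a D which satisfies (alpha, beta, gamma) also satisfies every
x (alpha, beta, gamma) + y (alpha, gamma, beta) ([CDer_sym_comb]), in particular
the sum (2 alpha, beta + gamma, beta + gamma) and the difference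
(0, beta - gamma, gamma - beta), and these two give back the original triple. The
classification is then elementary: rescale, according to which of beta - gamma,
beta + gamma, alpha vanish. The space (1, 0, 0) is the only one for which
the polynomials have to be opened: the coefficient of mu^n in T(a, b) is D
applied to the n-th coefficient of the bracket ([coef_at2]).

All identities between substitutions are instances of one universal property
([polym_ext]): an additive map on M[x] is determined by its values on the
constants and by a scalar through which it carries multiplication by x. *)

(** * Additive maps and linear relations *)

Section ZmodMorphism.
Context (U V : zmodType) (f : U -> V) (fB : zmod_morphism f).

Let F : {additive U -> V} := HB.pack f (GRing.isZmodMorphism.Build _ _ f fB).

Lemma zmod_morphism0 : f 0 = 0. Proof. exact: (raddf0 F). Qed.
Lemma zmod_morphismN : {morph f : x / - x}. Proof. exact: (raddfN F). Qed.
Lemma zmod_morphismD : {morph f : x y / x + y}. Proof. exact: (raddfD F). Qed.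
End ZmodMorphism.

Section LinearRelations.
Context (S : comPzRingType) (V : lmodType S).

Lemma linear_rel_comb (x y a b c a' b' c' : S) (T P Q : V) :
  a *: T = b *: P + c *: Q -> a' *: T = b' *: P + c' *: Q ->
  (x * a + y * a') *: T = (x * b + y * b') *: P + (x * c + y * c') *: Q.
Proof.
move=> E E'; rewrite !scalerDl -!scalerA E E' !scalerDr.
exact: addrACA.
Qed.

Lemma scaler_swap (a b : S) (T : V) : a *: (b *: T) = b *: (a *: T).
Proof. by rewrite !scalerA mulrC. Qed.

Lemma linear_swap (a b : S) (T P Q W : V) :
  a *: (b *: T + P) + (b *: Q + W) = b *: (a *: T + Q) + (a *: P + W).
Proof. by rewrite !scalerDr scaler_swap addrACA. Qed.

Lemma linear_rel_terms (x a b c : S) (T P Q T' P' Q' : V) :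
  a *: T = b *: P + c *: Q -> a *: T' = b *: P' + c *: Q' ->
  a *: (x *: T + T') = b *: (x *: P + P') + c *: (x *: Q + Q').
Proof.
by move=> E E'; rewrite !scalerDr !(scaler_swap _ x) E E' scalerDr addrACA.
Qed.

Lemma linear_rel_000 (T P Q : V) : (0 : S) *: T = (0 : S) *: P + (0 : S) *: Q.
Proof. by rewrite !scale0r addr0. Qed.

Lemma linear_rel_100 (T P Q : V) :
  (1 : S) *: T = (0 : S) *: P + (0 : S) *: Q <-> T = 0.
Proof. by rewrite scale1r !scale0r addr0. Qed.

Lemma linear_rel_01N1 (T P Q : V) :
  (0 : S) *: T = (1 : S) *: P + (- 1 : S) *: Q <-> P = Q.
Proof.
rewrite scale0r scale1r scaleN1r; split=> [/esym/eqP|->]; last by rewrite subrr.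
by rewrite subr_eq0 => /eqP.
Qed.
End LinearRelations.

(** * Modules of polynomials *)

Section PolyModule.
Context (S : comNzRingType) (M : lmodType S).
Implicit Types (p : polym M) (m : M).

Lemma polymC_additive : zmod_morphism (@polymC S M).
Proof. by move=> m m'; rewrite /polymC monalgUB. Qed.

Lemma scaleX_monomial m n :
  'X *: (<< m *g n >> : polym M) = (<< m *g n.+1 >> : polym M).
Proof.
apply/malgP => k; rewrite (coef_polym_scale 'X (<< m *g n >> : polym M)).
case: k => [|k].
  by rewrite big_ord_recl big_ord0 coefX scale0r addr0 mcoeffU.
rewrite big_ord_recl coefX scale0r add0r big_ord_recl coefX /= scale1r subSS subn0.
rewrite big1 ?addr0 => [|i _]; last by rewrite coefX scale0r.
by rewrite !mcoeffU eqSS.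
Qed.

Lemma scaleC_polymC (c : S) m : c%:P *: polymC m = polymC (c *: m).
Proof.
apply/malgP => k; rewrite (coef_polym_scale c%:P (polymC m)) big_ord_recl subn0.
rewrite coefC /= big1 ?addr0 => [|i _]; last by rewrite coefC scale0r.
by rewrite !mcoeffU; case: k => [|k] //=; rewrite !mulr0n scaler0.
Qed.

Lemma polym_ind_monomial (P : polym M -> Prop) :
  (forall m n, P << m *g n >>) ->
  (forall p p', P p -> P p' -> P (p + p')) -> forall p, P p.
Proof.
move=> PU PD p; rewrite [p]monalgE.
elim/big_ind: _ => //.
by rewrite -(monalgU0 0%N); apply: PU.
Qed.

Lemma polym_ind (P : polym M -> Prop) :
  (forall m, P (polymC m)) -> (forall p, P p -> P ('X *: p)) ->
  (forall p p', P p -> P p' -> P (p + p')) -> forall p, P p.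
Proof.
move=> PC PX PD; elim/polym_ind_monomial => // m; elim=> [|n IHn].
  exact: PC.
by rewrite -(scaleX_monomial m n); apply/PX/IHn.
Qed.

Lemma polym_coef_additive n : zmod_morphism (fun p : polym M => p@_n).
Proof. by move=> p r; exact: mcoeffB. Qed.

Lemma polym_monomial_ext (N : zmodType) (f g : polym M -> N) :
  zmod_morphism f -> zmod_morphism g ->
  (forall m n, f << m *g n >> = g << m *g n >>) -> f =1 g.
Proof.
move=> fB gB fgU; elim/polym_ind_monomial => // p r fgp fgr.
by rewrite (zmod_morphismD fB) (zmod_morphismD gB) fgp fgr.
Qed.

Section Eval.
Context (S' : comNzRingType) (N : lmodType S') (iota : M -> N) (q : S').
Context (iotaB : zmod_morphism iota).

(** Sums over the supports of different polynomials can be compared only on a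
common index set. *)
Lemma polym_eval_widen (A : {fset nat}) p : (msupp p `<=` A)%fset ->
  polym_eval iota q p = \sum_(n <- A) q ^+ n *: iota p@_n.
Proof.
move=> le_pA; rewrite /polym_eval.
have iota0 : iota 0 = 0 by rewrite -[0 in LHS]subr0 iotaB subrr.
rewrite (big_fset_incl _ le_pA) // => n _ np.
by rewrite mcoeff_outdom // iota0 scaler0.
Qed.

Lemma polym_eval_additive : zmod_morphism (polym_eval iota q).
Proof.
move=> p r.
pose A := (msupp p `|` msupp r)%fset.
rewrite (@polym_eval_widen A p) ?fsubsetUl // (@polym_eval_widen A r) ?fsubsetUr //.
rewrite (@polym_eval_widen A) ?msuppB_le // -sumrB.
by apply: eq_bigr => n _; rewrite mcoeffB iotaB scalerBr.
Qed.

Lemma polym_eval_monomial m n :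
  polym_eval iota q (<< m *g n >> : polym M) = q ^+ n *: iota m.
Proof.
by rewrite (@polym_eval_widen [fset n]%fset) ?msuppU_le // big_seq_fset1 mcoeffUU.
Qed.

Lemma polym_eval_polymC m : polym_eval iota q (polymC m) = iota m.
Proof. by rewrite polym_eval_monomial scale1r. Qed.

Lemma polym_eval_scaleX p :
  polym_eval iota q ('X *: p) = q *: polym_eval iota q p.
Proof.
elim/polym_ind_monomial: p => [m n|p r IHp IHr].
  rewrite (scaleX_monomial m n) (polym_eval_monomial m n) (polym_eval_monomial m n.+1).
  by rewrite scalerA exprS.
by rewrite scalerDr !(zmod_morphismD polym_eval_additive) IHp IHr scalerDr.
Qed.
End Eval.

(** The universal property of M[x]: it is generated by the constants under
addition and multiplication by x. *)
Lemma polym_ext (S' : comNzRingType) (N : lmodType S') (q : S')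
    (f g : polym M -> N) :
  zmod_morphism f -> zmod_morphism g ->
  (forall p, f ('X *: p) = q *: f p) -> (forall p, g ('X *: p) = q *: g p) ->
  (forall m, f (polymC m) = g (polymC m)) -> f =1 g.
Proof.
move=> fB gB fX gX fgC; elim/polym_ind => // [p|p r] IHp; first by rewrite fX gX IHp.
by move=> IHr; rewrite (zmod_morphismD fB) (zmod_morphismD gB) IHp IHr.
Qed.

Lemma polym_eval_linear (S' : comNzRingType) (N : lmodType S') (q c : S')
    (iota kappa : M -> N) p :
  polym_eval (fun m => c *: iota m + kappa m) q p =
  c *: polym_eval iota q p + polym_eval kappa q p.
Proof.
rewrite /polym_eval scaler_sumr -big_split; apply: eq_bigr => n _ /=.
by rewrite scalerDr !scalerA mulrC.
Qed.

(** c' is independent of c because a conformal map D_lambda carries c = d to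
c' = d + lambda. *)
Lemma polym_eval_scaleC (S' : comNzRingType) (N : lmodType S')
    (iota : M -> N) (q : S') (c : S) (c' : S') p :
  zmod_morphism iota -> (forall m, iota (c *: m) = c' *: iota m) ->
  polym_eval iota q (c%:P *: p) = c' *: polym_eval iota q p.
Proof.
move=> iB iZ; have eB := polym_eval_additive q iB.
elim/polym_ind: p => [m|p IHp|p r IHp IHr].
- by rewrite scaleC_polymC !polym_eval_polymC.
- rewrite scalerA mulrC -scalerA !polym_eval_scaleX // IHp.
  by rewrite !scalerA mulrC.
- by rewrite !scalerDr !(zmod_morphismD eB) scalerDr IHp IHr.
Qed.
End PolyModule.

(** * Substitutions in R[lambda, mu] *)

Section Substitution.
Context (K : realType) (R : lmodType (Cdiff K)).
Implicit Types (f : R -> polym R) (v : polym R) (q s t : {poly {poly Cdiff K}}).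

Lemma zmod_morphism_Clinear f : Clinear f -> zmod_morphism f.
Proof.
move=> flin x y; rewrite [x - y]addrC.
have := flin (-1) y x; rewrite !polyCN !scaleN1r => ->.
by rewrite addrC.
Qed.

Lemma Clinear_scale f : Clinear f -> forall c x, f (c%:P *: x) = c%:P%:P *: f x.
Proof.
move=> flin c x; have := flin c x 0.
by rewrite !addr0 (zmod_morphism0 (zmod_morphism_Clinear flin)) addr0.
Qed.

Lemma polymCC_additive : zmod_morphism (fun m : R => polymC (polymC m)).
Proof. by move=> x y; rewrite !polymC_additive. Qed.

(** The substitution lambda := q from R[lambda] to R[lambda, mu]; it is the inner
evaluation in [at2], so [at2 f q v s] is the sum of the s^n f(v_n)(q). *)
Definition lam_subst q : polym R -> polym (polym R) :=
  polym_eval (fun m => polymC (polymC m)) q.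

Lemma lam_subst_additive q : zmod_morphism (lam_subst q).
Proof. exact/polym_eval_additive/polymCC_additive. Qed.

Lemma lam_subst_scaleX q p : lam_subst q ('X *: p) = q *: lam_subst q p.
Proof. exact/polym_eval_scaleX/polymCC_additive. Qed.

Lemma lam_subst_scaleC q c p : lam_subst q (c%:P *: p) = c%:P%:P *: lam_subst q p.
Proof.
apply: polym_eval_scaleC => [|m]; first exact: polymCC_additive.
by rewrite !scaleC_polymC.
Qed.

Lemma lam_subst_polymC q m : lam_subst q (polymC m) = polymC (polymC m).
Proof. exact/polym_eval_polymC/polymCC_additive. Qed.

Section At2.
Context (f : R -> polym R) (q s : {poly {poly Cdiff K}}).
Context (fB : zmod_morphism f).

Let iotaB : zmod_morphism (fun x => lam_subst q (f x)).
Proof. by move=> x y; rewrite fB lam_subst_additive. Qed.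

Lemma at2_additive : zmod_morphism (fun v => at2 f q v s).
Proof. exact: polym_eval_additive. Qed.

Lemma at2_scaleX v : at2 f q ('X *: v) s = s *: at2 f q v s.
Proof. exact: polym_eval_scaleX. Qed.

Lemma at2_polymC x : at2 f q (polymC x) s = lam_subst q (f x).
Proof. exact: polym_eval_polymC. Qed.

(** Sesquilinear maps f move a scalar c of R to a polynomial in lambda, which the
substitution turns into c'. *)
Lemma at2_scaleC c c' v :
  (forall x, lam_subst q (f (c *: x)) = c' *: lam_subst q (f x)) ->
  at2 f q (c%:P *: v) s = c' *: at2 f q v s.
Proof. exact: polym_eval_scaleC. Qed.
End At2.

Lemma at2_scale f q s (c : K[i]) v : Clinear f ->
  at2 f q (c%:P%:P *: v) s = c%:P%:P%:P *: at2 f q v s.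
Proof.
move=> flin; apply: at2_scaleC => [|x]; first exact: zmod_morphism_Clinear.
by rewrite Clinear_scale // lam_subst_scaleC.
Qed.

Lemma at2_linear (f g : R -> polym R) q s (c : K[i]) v :
  at2 (c%:P%:P *: f + g) q v s = c%:P%:P%:P *: at2 f q v s + at2 g q v s.
Proof.
rewrite /at2 -polym_eval_linear; congr (polym_eval _ s v); apply/funext => x.
rewrite -[LHS]/(lam_subst q (c%:P%:P *: f x + g x)).
by rewrite (zmod_morphismD (lam_subst_additive q)) lam_subst_scaleC.
Qed.

Lemma at2_0 q (v : polym R) s : at2 (0 : R -> polym R) q v s = 0.
Proof.
apply: big1 => n _; rewrite -[X in _ *: X]/(lam_subst q (0 : polym R)).
by rewrite (zmod_morphism0 (lam_subst_additive q)) scaler0.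
Qed.

Lemma lam_subst_lam (p : polym R) : lam_subst lam p = polymC p.
Proof.
move: p; apply: (@polym_ext _ R _ (polym (polym R)) lam (lam_subst lam)
  (@polymC _ (polym R))).
- exact: lam_subst_additive.
- exact: polymC_additive.
- exact: lam_subst_scaleX.
- by move=> p; rewrite scaleC_polymC.
- exact: lam_subst_polymC.
Qed.

Lemma at2_monomial (D : R -> polym R) m k : zmod_morphism D ->
  at2 D lam (<< m *g k >> : polym R) mu = << D m *g k >>.
Proof.
move=> DB; elim: k => [|k IHk].
  by rewrite -[X in at2 D lam X mu]/(polymC m) at2_polymC // lam_subst_lam.
rewrite -(scaleX_monomial m k) at2_scaleX // IHk.
exact: scaleX_monomial.
Qed.

(** In D_lambda(v(mu)), with v not involving lambda, the powers of mu are kept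
apart, so this element vanishes only if D kills each coefficient of v. *)
Lemma coef_at2 (D : R -> polym R) v n : zmod_morphism D ->
  (at2 D lam v mu)@_n = D v@_n.
Proof.
move=> DB; move: v.
apply: (@polym_monomial_ext _ R (polym R) (fun v => (at2 D lam v mu)@_n)
          (fun v => D v@_n)).
- move=> v w; rewrite at2_additive //; exact: polym_coef_additive.
- by move=> v w; rewrite polym_coef_additive DB.
move=> m k; rewrite at2_monomial //.
apply: (etrans (mcoeffU _ _ _)).
by rewrite mcoeffU; case: eqP => // _; rewrite (zmod_morphism0 DB).
Qed.

(** The value - lambda - mu - d of mu for which, with lambda fixed, lambda + mu
and - mu - d are exchanged. *)
Definition skew_pt : {poly {poly Cdiff K}} := - (lam + mu) - 'X%:P%:P.
Definition skew_subst : polym (polym R) -> polym (polym R) :=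
  polym_eval (@polymC _ (polym R)) skew_pt.

Lemma skew_additive : zmod_morphism skew_subst.
Proof. exact/polym_eval_additive/polymC_additive. Qed.

Lemma skew_mu P : skew_subst (mu *: P) = skew_pt *: skew_subst P.
Proof. exact/polym_eval_scaleX/polymC_additive. Qed.

Lemma skew_scaleC (c : {poly Cdiff K}) P :
  skew_subst (c%:P *: P) = c%:P *: skew_subst P.
Proof.
apply: polym_eval_scaleC => [|p]; first exact: polymC_additive.
by rewrite scaleC_polymC.
Qed.

Lemma skew_rel (a b c : {poly Cdiff K}) (T P Q : polym (polym R)) :
  a%:P *: T = b%:P *: P + c%:P *: Q ->
  a%:P *: skew_subst T = b%:P *: skew_subst P + c%:P *: skew_subst Q.
Proof.
move/(congr1 skew_subst).
by rewrite (zmod_morphismD skew_additive) !skew_scaleC.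
Qed.

Lemma skew_lam_subst q q' p :
  (forall P, skew_subst (q *: P) = q' *: skew_subst P) ->
  skew_subst (lam_subst q p) = lam_subst q' p.
Proof.
move=> skewq; move: p.
apply: (@polym_ext _ _ _ _ q' (fun p => skew_subst (lam_subst q p)) (lam_subst q')).
- by move=> p r; rewrite lam_subst_additive skew_additive.
- exact: lam_subst_additive.
- by move=> p; rewrite lam_subst_scaleX skewq.
- exact: lam_subst_scaleX.
- move=> m; rewrite !lam_subst_polymC; exact/polym_eval_polymC/polymC_additive.
Qed.

Lemma skew_at2 f q q' s s' v : zmod_morphism f ->
  (forall P, skew_subst (q *: P) = q' *: skew_subst P) ->
  (forall P, skew_subst (s *: P) = s' *: skew_subst P) ->
  skew_subst (at2 f q v s) = at2 f q' v s'.
Proof.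
move=> fB skewq skews; move: v.
apply: (@polym_ext _ _ _ _ s' (fun v => skew_subst (at2 f q v s))
          (fun v => at2 f q' v s')).
- by move=> p r; rewrite at2_additive // skew_additive.
- exact: at2_additive.
- by move=> p; rewrite at2_scaleX // skews.
- by move=> p; rewrite at2_scaleX.
- by move=> m; rewrite !at2_polymC // (skew_lam_subst _ skewq).
Qed.

(** With p = [b_lambda a], the left-hand side is, up to sign, [a_q b] expanded by
skew-symmetry. *)
Lemma lam_subst_skew q p :
  lam_subst q (polym_eval (@polymC _ R) (- 'X - 'X%:P) p) =
  lam_subst (- q - 'X%:P%:P) p.
Proof.
move: p; apply: (@polym_ext _ _ _ _ (- q - 'X%:P%:P)
  (fun p => lam_subst q (polym_eval (@polymC _ R) (- 'X - 'X%:P) p)) (lam_subst _)).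
- by move=> p r; rewrite (polym_eval_additive _ (@polymC_additive _ R)) lam_subst_additive.
- exact: lam_subst_additive.
- move=> p; rewrite (polym_eval_scaleX _ (@polymC_additive _ R)).
  rewrite !scalerBl !scaleNr lam_subst_additive (zmod_morphismN (lam_subst_additive q)).
  by rewrite lam_subst_scaleX lam_subst_scaleC.
- exact: lam_subst_scaleX.
- by move=> m; rewrite (polym_eval_polymC _ (@polymC_additive _ R)) !lam_subst_polymC.
Qed.

(** Since D_lambda d = (d + lambda) D_lambda, applying D_lambda to a polynomial
in - mu - d turns that argument into - mu - (d + lambda). *)
Lemma at2_skew D v :
  (Clinear D /\ forall a, D ('X *: a) = ('X%:P + 'X) *: D a) ->
  at2 D lam (polym_eval (@polymC _ R) (- 'X - 'X%:P) v) mu =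
  at2 D lam v skew_pt.
Proof.
case=> Dlin DX; have DB := zmod_morphism_Clinear Dlin.
move: v; apply: (@polym_ext _ _ _ _ skew_pt
  (fun v => at2 D lam (polym_eval (@polymC _ R) (- 'X - 'X%:P) v) mu)
  (fun v => at2 D lam v skew_pt)).
- by move=> p r; rewrite (polym_eval_additive _ (@polymC_additive _ R)) at2_additive.
- exact: at2_additive.
- move=> v; rewrite (polym_eval_scaleX _ (@polymC_additive _ R)).
  rewrite scalerBl scaleNr at2_additive // (zmod_morphismN (at2_additive _ _ DB)).
  rewrite at2_scaleX // (@at2_scaleC _ _ _ DB _ ('X%:P%:P + lam)) => [|x].
    by rewrite -scaleNr -scalerBl; congr (_ *: _); rewrite /skew_pt /mu; ring.
  rewrite DX !scalerDl (zmod_morphismD (lam_subst_additive _)).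
  by rewrite lam_subst_scaleX lam_subst_scaleC.
- by move=> v; rewrite at2_scaleX.
- by move=> m; rewrite (polym_eval_polymC _ (@polymC_additive _ R)) !at2_polymC.
Qed.
End Substitution.

(** * Conformal (alpha, beta, gamma)-derivations *)

Section Conformal.
Context (K : realType) (R : lieConformal K).
Implicit Types (D : R -> polym R) (a b : R) (v : polym R).

Lemma bracketlB b : zmod_morphism (bracket^~ b).
Proof. exact/zmod_morphism_Clinear/bracket_linearl. Qed.
Lemma bracketrB a : zmod_morphism (bracket a).
Proof. exact/zmod_morphism_Clinear/bracket_linearr. Qed.

Lemma at2_bracketC b v q s :
  at2 (bracket^~ b) q v s = - at2 (bracket b) (- q - 'X%:P%:P) v s.
Proof.
rewrite /at2 /polym_eval -sumrN; apply: eq_bigr => n _; rewrite -scalerN.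
congr (_ *: _); rewrite -[LHS]/(lam_subst q (bracket _ b)) bracket_skew.
by rewrite (zmod_morphismN (lam_subst_additive q)) lam_subst_skew.
Qed.

Lemma derive_bracketC D a b : Cend R D ->
  at2 D lam (bracket a b) mu = - skew_subst (at2 D lam (bracket b a) mu).
Proof.
move=> Dcend; have DB := zmod_morphism_Clinear (proj1 Dcend).
rewrite bracket_skew (zmod_morphismN (at2_additive lam mu DB)).
rewrite (@at2_skew _ R D (bracket b a) Dcend).
by rewrite (skew_at2 _ DB (skew_scaleC 'X) (@skew_mu _ _)).
Qed.

Lemma bracketl_skew b v :
  at2 (bracket^~ b) (lam + mu) v lam = - skew_subst (at2 (bracket b) mu v lam).
Proof.
by rewrite at2_bracketC (skew_at2 _ (bracketrB b) (@skew_mu _ _) (skew_scaleC 'X)).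
Qed.

Lemma bracketr_skew a v :
  at2 (bracket a) mu v lam = - skew_subst (at2 (bracket^~ a) (lam + mu) v lam).
Proof.
have -> : skew_subst (at2 (bracket^~ a) (lam + mu) v lam) =
          at2 (bracket^~ a) (- mu - 'X%:P%:P) v lam; last first.
  by rewrite at2_bracketC opprK; congr at2; ring.
apply: (@skew_at2 _ R (bracket^~ a)); first exact: bracketlB.
- move=> P; rewrite scalerDl (zmod_morphismD (@skew_additive _ R)) skew_mu skew_scaleC.
  by rewrite -scalerDl; congr (_ *: _); rewrite /skew_pt; ring.
- exact: skew_scaleC.
Qed.

Lemma CDerP alpha beta gamma D :
  CDer R alpha beta gamma D <-> Cend R D /\ forall a b,
     alpha%:P%:P%:P *: at2 D lam (bracket a b) mu =
     beta%:P%:P%:P *: at2 (bracket^~ b) (lam + mu) (D a) lam +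
     gamma%:P%:P%:P *: at2 (bracket a) mu (D b) lam.
Proof.
by split=> -[Dcend Deq]; split=> [//|a b]; move: (Deq a b);
    rewrite !at2_scale //; (exact: bracket_linearl || exact: bracket_linearr).
Qed.

(** Minus the substitution [skew_subst], applied to the relation for (b, a), gives
the relation for (a, b) with the last two terms exchanged. *)
Lemma CDer_swap alpha beta gamma D :
  CDer R alpha beta gamma D -> CDer R alpha gamma beta D.
Proof.
move=> /CDerP[Dcend Deq]; apply/CDerP; split=> [//|a b].
have Deq_skew := skew_rel (Deq b a).
rewrite (derive_bracketC a b Dcend) (bracketl_skew b (D a)) (bracketr_skew a (D b)).
rewrite !scalerN -opprD; congr (- _).
apply: (etrans Deq_skew); exact: addrC.
Qed.

Lemma CDer_comb (x y al be ga al' be' ga' : K[i]) D :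
  CDer R al be ga D -> CDer R al' be' ga' D ->
  CDer R (x * al + y * al') (x * be + y * be') (x * ga + y * ga') D.
Proof.
move=> /CDerP[Dcend Deq] /CDerP[_ Deq']; apply/CDerP; split=> [//|a b].
rewrite !(polyCD, polyCM); exact: linear_rel_comb (Deq a b) (Deq' a b).
Qed.

(** Both symmetries at once: passing from one triple to another amounts to solving
for x and y. *)
Lemma CDer_sym_comb (x y al be ga al' be' ga' : K[i]) D :
  CDer R al be ga D -> x * al + y * al = al' ->
  x * be + y * ga = be' -> x * ga + y * be = ga' -> CDer R al' be' ga' D.
Proof.
move=> Dder <- <- <-; exact: CDer_comb Dder (CDer_swap Dder).
Qed.

Lemma CDer_scale (k al be ga al' be' ga' : K[i]) :
  k != 0 -> al = k * al' -> be = k * be' -> ga = k * ga' ->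
  CDer R al be ga = CDer R al' be' ga'.
Proof.
move=> k_neq0 -> -> ->; apply/seteqP; split=> D Dder.
  by apply: (CDer_sym_comb (x := k^-1) (y := 0) Dder); rewrite mul0r addr0 mulKf.
by apply: (CDer_sym_comb (x := k) (y := 0) Dder); rewrite mul0r addr0.
Qed.

Lemma scalar0 : (0 : K[i])%:P%:P%:P = 0 :> {poly {poly Cdiff K}}.
Proof. by rewrite !polyC0. Qed.
Lemma scalar1 : (1 : K[i])%:P%:P%:P = 1 :> {poly {poly Cdiff K}}.
Proof. by rewrite !polyC1. Qed.
Lemma scalarN1 : (-1 : K[i])%:P%:P%:P = -1 :> {poly {poly Cdiff K}}.
Proof. by rewrite !polyCN !polyC1. Qed.

Lemma CDer_000 : CDer R 0 0 0 = Cend R.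
Proof.
apply/seteqP; split=> D; first by case/CDerP.
move=> Dcend; apply/CDerP; split=> [//|a b].
rewrite scalar0; exact: linear_rel_000.
Qed.

Lemma CDer_100P D : CDer R 1 0 0 D <->
  Cend R D /\ forall a b n, D (bracket a b)@_n = 0.
Proof.
rewrite CDerP scalar0 scalar1; split=> -[Dcend D0]; split=> // a b;
  have DB := zmod_morphism_Clinear (proj1 Dcend).
  move=> n; rewrite -(coef_at2 _ _ DB).
  by have /linear_rel_100 -> := D0 a b; rewrite mcoeff0.
apply/linear_rel_100/malgP => n; apply: (etrans (coef_at2 _ _ DB)).
by rewrite D0 mcoeff0.
Qed.

Lemma CDer_100 :
  CDer R 1 0 0 = [set D | Cend R D /\ forall x, derived R x -> D x = 0].
Proof.
apply/seteqP; split=> D.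
  move=> /CDer_100P[Dcend D0]; split=> [//|_ [n [c [v [vP ->]]]]].
  have DB := zmod_morphism_Clinear (proj1 Dcend).
  rewrite (big_morph D (zmod_morphismD DB) (zmod_morphism0 DB)).
  apply: big1 => i _; rewrite (Clinear_scale (proj1 Dcend)).
  by have [a [b [k ->]]] := vP i; rewrite D0 scaler0.
move=> [Dcend D0]; apply/CDer_100P; split=> [//|a b n]; apply: D0.
exists 1%N, (fun=> 1), (fun=> (bracket a b)@_n); split=> [_|]; first by exists a, b, n.
by rewrite big_ord1 scale1r.
Qed.

Lemma CDer_01N1 : CDer R 0 1 (-1) = QC R.
Proof.
apply/seteqP; split=> D.
  move=> /CDerP[Dcend]; rewrite scalar0 scalar1 scalarN1 => Deq; split=> [//|a b].
  by have /linear_rel_01N1 := Deq a b.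
move=> [Dcend Deq]; apply/CDerP; rewrite scalar0 scalar1 scalarN1.
by split=> [//|a b]; apply/linear_rel_01N1.
Qed.

Lemma Cend_comb (c : K[i]) D E :
  Cend R D -> Cend R E -> Cend R (c%:P%:P *: D + E).
Proof.
move=> [Dlin DX] [Elin EX].
have combE x : (c%:P%:P *: D + E) x = c%:P%:P *: D x + E x by [].
split=> [k x y|x]; rewrite !combE.
  by rewrite Dlin Elin linear_swap.
by rewrite DX EX [in RHS]scalerDr scaler_swap.
Qed.

Lemma CDer_subspace al be ga : Csubspace (CDer R al be ga).
Proof.
split=> [D []//| |c D E /CDerP[Dcend Deq] /CDerP[Ecend Eeq]].
  apply/CDerP; split=> [|a b].
    by split=> [c x y|x]; rewrite /= ?scaler0 ?addr0.
  rewrite (zmod_morphism0 (at2_additive _ _ (bracketlB b))).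
  rewrite (zmod_morphism0 (at2_additive _ _ (bracketrB a))) at2_0.
  by rewrite !scaler0 addr0.
apply/CDerP; split=> [|a b]; first exact: Cend_comb.
have addl := zmod_morphismD (at2_additive (lam + mu) lam (bracketlB b)).
have addr := zmod_morphismD (at2_additive mu lam (bracketrB a)).
rewrite at2_linear (addl (c%:P%:P *: D a)) (addr (c%:P%:P *: D b)).
rewrite (at2_scale _ _ _ _ (bracket_linearl b)) (at2_scale _ _ _ _ (bracket_linearr a)).
exact: linear_rel_terms (Deq a b) (Eeq a b).
Qed.

Lemma CDer_delta1N1 delta : delta <> 0 ->
  CDer R delta 1 (-1) = CDer R 0 1 (-1) `&` CDer R 1 0 0.
Proof.
move=> /eqP delta_neq0; apply/seteqP; split=> D.
  move=> Dder; split.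
    by apply: (CDer_sym_comb (x := 2^-1) (y := - 2^-1) Dder); field.
  by apply: (CDer_sym_comb (x := (2 * delta)^-1) (y := (2 * delta)^-1) Dder); field.
move=> [DQ DZ]; have := CDer_comb 1 delta DQ DZ.
by rewrite !mulr0 !mulr1 !mul1r add0r !addr0.
Qed.

Lemma CDer_delta10 delta :
  CDer R delta 1 0 = CDer R 0 1 (-1) `&` CDer R (2 * delta) 1 1.
Proof.
apply/seteqP; split=> D.
  move=> Dder; split.
    by apply: (CDer_sym_comb (x := 1) (y := -1) Dder); ring.
  by apply: (CDer_sym_comb (x := 1) (y := 1) Dder); ring.
move=> [DQ DS]; have := CDer_comb 2^-1 2^-1 DQ DS.
by congr (CDer R _ _ _ D); field.
Qed.

Lemma CDer_cases al be ga :
     CDer R al be ga = CDer R 0 0 0 \/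
     CDer R al be ga = CDer R 1 0 0 \/
     CDer R al be ga = CDer R 0 1 (-1) \/
     (exists delta : K[i], delta <> 0 /\ CDer R al be ga = CDer R delta 1 (-1)) \/
     (exists delta : K[i], CDer R al be ga = CDer R delta 1 1) \/
     (exists delta : K[i], CDer R al be ga = CDer R delta 1 0).
Proof.
have [<-|be_neq_ga] := eqVneq be ga.
  have [->|be_neq0] := eqVneq be 0.
    have [->|al_neq0] := eqVneq al 0; first by left.
    by right; left; apply: (CDer_scale al_neq0); rewrite ?mulr1 ?mulr0.
  do 4!right; left; exists (be^-1 * al).
  by apply: (CDer_scale be_neq0); rewrite ?mulVKf ?mulr1.
have [/eqP|bega_neq0] := eqVneq (be + ga) 0.
  rewrite addrC addr_eq0 => /eqP ga_eq; rewrite ga_eq in be_neq_ga *.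
  have be_neq0 : be != 0 by apply: contraNneq be_neq_ga => ->; rewrite oppr0.
  have [->|al_neq0] := eqVneq al 0.
    by do 2!right; left; apply: (CDer_scale be_neq0); rewrite ?mulr0 ?mulrN ?mulr1.
  do 3!right; left; exists (be^-1 * al); split.
    by apply/eqP; rewrite mulf_neq0 ?invr_eq0.
  by apply: (CDer_scale be_neq0); rewrite ?mulVKf // ?mulrN ?mulr1.
do 5!right; exists (al / (be + ga)).
have bega_neq0' : be - ga != 0 by rewrite subr_eq0.
apply/seteqP; split=> D Dder.
  (* x and y solve x be + y ga = 1 and x ga + y be = 0, a system of determinant
     be^2 - ga^2. *)
  pose e := ((be + ga) * (be - ga))^-1.
  apply: (CDer_sym_comb (x := be * e) (y := - ga * e) Dder); rewrite /e; field;
    exact/andP.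
by apply: (CDer_sym_comb (x := be) (y := ga) Dder); field.
Qed.
End Conformal.

Theorem theorem4p4 (K : realType) (R : lieConformal K) :
  (forall alpha beta gamma : K[i],
     Csubspace (CDer R alpha beta gamma) /\
     (CDer R alpha beta gamma = CDer R 0 0 0 \/
      CDer R alpha beta gamma = CDer R 1 0 0 \/
      CDer R alpha beta gamma = CDer R 0 1 (-1) \/
      (exists delta : K[i],
         delta <> 0 /\ CDer R alpha beta gamma = CDer R delta 1 (-1)) \/
      (exists delta : K[i], CDer R alpha beta gamma = CDer R delta 1 1) \/
      (exists delta : K[i], CDer R alpha beta gamma = CDer R delta 1 0))) /\
  CDer R 0 0 0 = Cend R /\
  CDer R 1 0 0 = [set D | Cend R D /\ forall x, derived R x -> D x = 0] /\
  CDer R 0 1 (-1) = QC R /\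
  (forall delta : K[i], delta <> 0 ->
     CDer R delta 1 (-1) = CDer R 0 1 (-1) `&` CDer R 1 0 0) /\
  (forall delta : K[i],
     CDer R delta 1 0 = CDer R 0 1 (-1) `&` CDer R (2 * delta) 1 1).
Proof.
split; first by move=> al be ga; split; [exact: CDer_subspace|exact: CDer_cases].
do !split.
- exact: CDer_000.
- exact: CDer_100.
- exact: CDer_01N1.
- exact: CDer_delta1N1.
- exact: CDer_delta10.
Qed.
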